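(* A polynomial $F\in\mathbb C[x,y,s,t]$ of degree $d$ is Cartesian if and only if there exist sets $I,J\subset\mathbb C^2$ with $|I|,|J|>d^2$ such that $I\times J\subset Z(F)$.
   Context: $I\times J$ is viewed as a subset of $\mathbb C^4$ with coordinates $(x,y,s,t)$, $I$ in the $(x,y)$-coordinates and $J$ in the $(s,t)$-coordinates; $Z(F)$ is the complex zero set of $F$. $F$ is Cartesian if there exist $G\in\mathbb C[x,y]\setminus\mathbb C$, $K\in\mathbb C[s,t]\setminus\mathbb C$ and $H,L\in\mathbb C[x,y,s,t]$ with $F=G(x,y)H(x,y,s,t)+K(s,t)L(x,y,s,t)$. *)

(* Defs.v *)
From HB Require Import structures.
From mathcomp Require Import all_boot all_order all_algebra.
From mathcomp Require Import reals.
From mathcomp Require Import complex.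
From mathcomp Require Import mpoly.
Set Implicit Arguments. Unset Strict Implicit. Unset Printing Implicit Defensive.
Import Order.TTheory GRing.Theory Num.Theory.
Local Open Scope ring_scope.

Definition CC (R : realType) := complex R.

Definition vx : 'I_4 := inord 0.
Definition vy : 'I_4 := inord 1.
Definition vs : 'I_4 := inord 2.
Definition vt : 'I_4 := inord 3.

(* Total degree of a multivariate polynomial (msize p = 1 + deg p, 0 for p = 0). *)
Definition mtdeg (K : ringType) n (p : {mpoly K[n]}) : nat := (msize p).-1.

Definition nonconst (K : ringType) n (p : {mpoly K[n]}) : Prop :=
  ~ exists c : K, p = c%:MP.

Definition in_xy (K : comRingType) (G : {mpoly K[2]}) : {mpoly K[4]} :=
  G \mPo [tuple 'X_vx; 'X_vy].
Definition in_st (K : comRingType) (G : {mpoly K[2]}) : {mpoly K[4]} :=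
  G \mPo [tuple 'X_vs; 'X_vt].

Definition cartesian (K : comRingType) (F : {mpoly K[4]}) : Prop :=
  exists (G Kp : {mpoly K[2]}) (H L : {mpoly K[4]}),
    nonconst G /\ nonconst Kp /\ F = in_xy G * H + in_st Kp * L.

Definition pt4 (K : Type) (p q : K * K) : 'I_4 -> K :=
  fun i => nth p.1 [:: p.1; p.2; q.1; q.2] (val i).

Definition card_gt (T : eqType) (A : T -> Prop) (n : nat) : Prop :=
  exists s : seq T, uniq s /\ (forall x, x \in s -> A x) /\ (n < size s)%N.

(* Main.v *)
(** A nonconstant [G] has infinitely many zeros over an algebraically closed
    field, which settles one direction.  Conversely, a family of polynomials in
    two variables of degree at most [d] with more than [d^2] common zeros has a
    nonconstant common factor (a form of Bezout's inequality).  Applied to the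
    slices [F(., q)], [q] in [J], it gives [G] dividing all of them.  Write
    [F = sum C_ij m_i(x,y) m_j(s,t)] with monomials [m_i], and let [P] project
    coefficient vectors onto the span of these slices.  Then the part of [F]
    obtained by applying [P] to the [x,y]-side is divisible by [G], while the
    [s,t]-coefficients of the rest vanish on [J] and so share a factor [K]. *)

Require Import Defs.
From HB Require Import structures.
From mathcomp Require Import all_boot all_order all_algebra.
From mathcomp Require Import reals complex mpoly zify.
Set Implicit Arguments. Unset Strict Implicit. Unset Printing Implicit Defensive.
Import GRing.Theory.
Local Open Scope ring_scope.

(** * Divisibility in K[X][Y]: irreducible elements are prime *)

Lemma dvd_XsubC_of_horner0 (K : fieldType) (a : K) (u : {poly {poly K}}) :
  map_poly (horner_eval a) u = 0 -> exists u', u = ('X - a%:P)%:P * u'.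
Proof.
move=> u0; exists (map_poly (fun p => p %/ ('X - a%:P)) u).
apply/polyP=> i; rewrite coefCM coef_map_id0 ?div0p // mulrC divpK //.
have /polyP/(_ i) := u0; rewrite coef0 coef_map /= => /eqP.
by rewrite -[_ == 0]/(root _ _) root_factor_theorem.
Qed.

(** Setting the inner variable to [a] lands in the integral domain K[Y], where one of the two
    factors must vanish. *)
Lemma XsubC_prime (K : fieldType) (a : K) (h u v : {poly {poly K}}) :
  ('X - a%:P)%:P * h = u * v ->
  (exists u', u = ('X - a%:P)%:P * u') \/ (exists v', v = ('X - a%:P)%:P * v').
Proof.
move/(congr1 (map_poly (horner_eval a))); rewrite !rmorphM /= map_polyC /=.
rewrite /horner_eval hornerXsubC subrr mul0r => /esym/eqP.
by rewrite mulf_eq0 => /orP[] /eqP /dvd_XsubC_of_horner0; [left | right].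
Qed.

(* Gauss's lemma: the linear factors of [c] are primes of [K[X][Y]]. *)
Lemma polyCC_factor (K : closedFieldType) (c : {poly K}) (h u v : {poly {poly K}}) :
  c != 0 -> c%:P * h = u * v ->
  exists (c1 c2 : {poly K}) (u' v' : {poly {poly K}}),
    [/\ c1 != 0, c2 != 0, u = c1%:P * u', v = c2%:P * v' & h = u' * v'].
Proof.
have [n] := ubnP (size c).
elim: n c u v => // n IHn c u v lt_cn c0 Ec.
have [/size_poly1P[k k0 Dc]|] := boolP (size c == 1).
  exists 1, k%:P, u, ((k^-1)%:P%:P * v); split; rewrite ?oner_eq0 ?polyC_eq0 //.
  - by rewrite mul1r.
  - by rewrite mulrA -!polyCM mulfV // mul1r.
  by rewrite mulrCA -Ec Dc mulrA -!polyCM mulVf // mul1r.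
case/closed_rootP=> a /factor_theorem[q Dc].
have Xa0 : 'X - a%:P != 0 by rewrite polyXsubC_eq0.
have XaC0 : ('X - a%:P)%:P != 0 :> {poly {poly K}} by rewrite polyC_eq0.
have q0 : q != 0 by apply: contraNneq c0 => q0; rewrite Dc q0 mul0r.
have lt_qn : (size q < n)%N.
  by move: lt_cn; rewrite Dc size_Mmonic ?monicXsubC // size_XsubC addn2.
have Eq : ('X - a%:P)%:P * (q%:P * h) = u * v.
  by rewrite -Ec Dc polyCM mulrA [_%:P * q%:P]mulrC.
case: (XsubC_prime Eq) => [[u1 Du]|[v1 Dv]].
  have Eq1 : q%:P * h = u1 * v.
    by apply: (mulfI XaC0); rewrite Eq Du mulrA.
  have [c1 [c2 [u' [v' [c10 c20 Du1 Dv Dh]]]]] := IHn _ _ _ lt_qn q0 Eq1.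
  exists (('X - a%:P) * c1), c2, u', v'; split; rewrite ?mulf_neq0 //.
  by rewrite Du Du1 polyCM mulrA.
have Eq1 : q%:P * h = u * v1.
  by apply: (mulfI XaC0); rewrite Eq Dv mulrCA.
have [c1 [c2 [u' [v' [c10 c20 Du Dv1 Dh]]]]] := IHn _ _ _ lt_qn q0 Eq1.
exists c1, (('X - a%:P) * c2), u', v'; split; rewrite ?mulf_neq0 //.
by rewrite Dv Dv1 polyCM mulrA.
Qed.

Definition scalarXY (K : nzRingType) (p : {poly {poly K}}) := exists k : K, p = k%:P%:P.

Definition irredXY (K : nzRingType) (f : {poly {poly K}}) :=
  ~ scalarXY f /\ forall a b, f = a * b -> scalarXY a \/ scalarXY b.

Lemma scalarXY_size (K : nzRingType) (p : {poly {poly K}}) : scalarXY p -> (size p <= 1)%N.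
Proof. by case=> k ->; apply: size_polyC_leq1. Qed.

Lemma size_polyCCM (K : fieldType) (c : {poly K}) (p : {poly {poly K}}) :
  c != 0 -> size (c%:P * p) = size p.
Proof. by move=> c0; rewrite mul_polyC size_scale. Qed.

(** Clears denominators: by Gauss's lemma [c] splits between [f] and [w], and the part taken from
    [f] is a scalar since [f] is irreducible of positive degree in the outer variable. *)
Lemma irredXY_dvd_polyC (K : closedFieldType) (c : {poly K})
    (f v w : {poly {poly K}}) :
  irredXY f -> (1 < size f)%N -> c != 0 -> c%:P * v = f * w -> exists v', v = f * v'.
Proof.
move=> [_ irr] szf c0 /(polyCC_factor c0)[c1 [c2 [f' [w' [c10 c20 Df Dw ->]]]]].
have [[k Dk]|] := irr _ _ Df; last first.
  by move/scalarXY_size; rewrite leqNgt -(size_polyCCM f' c10) -Df szf.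
have k0 : k != 0 by move: c10; rewrite -polyC_eq0 Dk !polyC_eq0.
exists ((k^-1)%:P%:P * w').
by rewrite Df Dk mulrACA -!polyCM mulfV // mul1r.
Qed.

(** If the outer variable is absent from [f], then [f] is a linear polynomial in the inner one, up
    to a scalar. Otherwise the Euclidean algorithm over K(X) decides, with denominators cleared by
    [irredXY_dvd_polyC]. *)
Lemma irredXY_prime (K : closedFieldType) (f g u v : {poly {poly K}}) :
  irredXY f -> f * u = g * v ->
  (exists g', g = f * g') \/ (exists v', v = f * v').
Proof.
move=> irrf Efu; have [nscf irr] := irrf.
have [szf|szf] := leqP (size f) 1.
  have Df := size1_polyC szf; set c := f`_0 in Df.
  have : size c != 1.
    by apply/negP=> /size_poly1P[k _ Dk]; apply: nscf; exists k; rewrite Df Dk.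
  case/closed_rootP=> a /factor_theorem[q Dc].
  have Df' : f = ('X - a%:P)%:P * q%:P by rewrite Df Dc -polyCM mulrC.
  have [[k /polyC_inj Dk]|[k /polyC_inj Dk]] := irr _ _ Df'.
    by have := size_XsubC a; rewrite Dk => sz; have := size_polyC_leq1 k; rewrite sz.
  have k0 : k != 0.
    apply/eqP=> k0; apply: nscf; exists 0.
    by rewrite Df' Dk k0 polyC0 mulr0.
  have fP w : ('X - a%:P)%:P * w = f * (k^-1%:P%:P * w).
    by rewrite Df' Dk -[RHS]mulrA; congr (_ * _); rewrite mulrA -!polyCM mulfV ?mul1r.
  move: Efu; rewrite {1}Df' -mulrA => /XsubC_prime[[w ->]|[w ->]]; rewrite fP;
    by [left; eexists | right; eexists].
have f0 : f != 0 by rewrite -size_poly_gt0 ltnW.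
have [szh|szh] := leqP (size (gcdp f g)) 1.
  (* A Bezout identity [c1 (a f + b g) = c2], multiplied by [v], shows that [f] divides [c2 v]. *)
  right.
  have cop : coprimep f g.
    by rewrite coprimep_def eqn_leq szh size_poly_gt0 gcdp_eq0 negb_and f0.
  have [[a b] /= /Pdiv.Idomain.eqpP[[c1 c2] /= /andP[c10 c20] Eab]] :=
    Pdiv.Idomain.Bezout_coprimepP _ _ cop.
  apply: (@irredXY_dvd_polyC _ c2 f v (c1%:P * (a * v + b * u))) => //.
  have -> : c2%:P = c2 *: 1 :> {poly {poly K}} by rewrite -mul_polyC mulr1.
  rewrite -Eab -mul_polyC -mulrA mulrDl [RHS]mulrCA; congr (_ * _).
  by rewrite mulrDr [f * (a * v)]mulrCA [f * (b * u)]mulrCA Efu !mulrA.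
(* The pseudo-gcd [h] has positive degree and divides [f] up to [c]; irreducibility makes it [f]
   times a polynomial in the inner variable alone, so [f] divides [d g]. *)
left.
have [[c q] /= c0 Ef] := Pdiv.Idomain.dvdpP _ _ (Pdiv.Idomain.dvdp_gcdl f g).
have [[d r] /= d0 Eg] := Pdiv.Idomain.dvdpP _ _ (Pdiv.Idomain.dvdp_gcdr f g).
set h := gcdp f g in szh Ef Eg.
rewrite -mul_polyC in Ef; rewrite -mul_polyC in Eg.
have [c1 [c2 [q' [h' [c10 c20 Dq Dh Df]]]]] := polyCC_factor c0 Ef.
have [[k Dk]|/scalarXY_size] := irr _ _ Df; last first.
  by rewrite leqNgt -(size_polyCCM h' c20) -Dh szh.
have k0 : k != 0 by apply: contraNneq f0 => k0; rewrite Df Dk k0 mul0r.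
apply: (@irredXY_dvd_polyC _ d f g (r * c2%:P * k^-1%:P%:P)) => //.
rewrite Eg Dh Df Dk [RHS]mulrC !mulrA; congr (_ * _).
by rewrite -!mulrA -!polyCM mulVf ?mulr1.
Qed.

(** * The isomorphism between K[x,y] and K[X][Y] *)

Lemma rmorph_mpoly_eq (K S : comNzRingType) n (f g : {rmorphism {mpoly K[n]} -> S}) :
  (forall c, f c%:MP = g c%:MP) -> (forall i, f 'X_i = g 'X_i) -> f =1 g.
Proof.
move=> fgC fgX p; rewrite [p]mpolyE !rmorph_sum; apply: eq_bigr => m _.
rewrite -mul_mpolyC !rmorphM fgC mpolyXE_id !rmorph_prod; congr (_ * _).
by apply: eq_bigr => i _; rewrite !rmorphXn fgX.
Qed.

(** Gives access to pseudo-division and to specialisation of one variable at a time. *)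
Definition toXY (K : comNzRingType) : {mpoly K[2]} -> {poly {poly K}} :=
  mmap (polyC \o polyC) (fun i : 'I_2 => if i == 0 then 'X%:P else 'X).

Fact toXY_is_additive (K : comNzRingType) : additive (@toXY K).
Proof. exact: mmap_is_additive. Qed.
HB.instance Definition _ (K : comNzRingType) :=
  GRing.isAdditive.Build {mpoly K[2]} {poly {poly K}} (@toXY K) (@toXY_is_additive K).

Fact toXY_is_multiplicative (K : comNzRingType) : multiplicative (@toXY K).
Proof. exact: mmap_is_multiplicative. Qed.
HB.instance Definition _ (K : comNzRingType) :=
  GRing.isMultiplicative.Build {mpoly K[2]} {poly {poly K}} (@toXY K)
    (@toXY_is_multiplicative K).

Definition ofX (K : comNzRingType) : {poly K} -> {mpoly K[2]} :=
  horner_eval 'X_0 \o map_poly (@mpolyC 2 K).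

HB.instance Definition _ (K : comNzRingType) := 
  GRing.RMorphism.copy (@ofX K : {poly K} -> {mpoly K[2]})
  (horner_eval 'X_0 \o map_poly (@mpolyC 2 K)).

Definition ofXY (K : comNzRingType) : {poly {poly K}} -> {mpoly K[2]} :=
  horner_eval 'X_1 \o map_poly (@ofX K).

HB.instance Definition _ (K : comNzRingType) := 
  GRing.RMorphism.copy (@ofXY K : {poly {poly K}} -> {mpoly K[2]})
  (horner_eval 'X_1 \o map_poly (@ofX K)).

Lemma toXYC (K : comNzRingType) (c : K) : toXY c%:MP = c%:P%:P.
Proof. exact: mmapC. Qed.

Lemma toXYX (K : comNzRingType) (i : 'I_2) :
  toXY 'X_i = if i == 0 then 'X%:P else 'X :> {poly {poly K}}.
Proof. by rewrite /toXY mmapX mmap1U. Qed.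

Lemma ofXC (K : comNzRingType) (c : K) : ofX c%:P = c%:MP.
Proof. by rewrite /ofX /= /horner_eval map_polyC /= hornerC. Qed.

Lemma ofXX (K : comNzRingType) : ofX 'X = 'X_0 :> {mpoly K[2]}.
Proof. by rewrite /ofX /= /horner_eval map_polyX hornerX. Qed.

Lemma ofXYC (K : comNzRingType) (c : {poly K}) : ofXY c%:P = ofX c.
Proof. by rewrite /ofXY /= /horner_eval map_polyC /= hornerC. Qed.

Lemma ofXYX (K : comNzRingType) : ofXY 'X = 'X_1 :> {mpoly K[2]}.
Proof. by rewrite /ofXY /= /horner_eval map_polyX hornerX. Qed.

Lemma ord2P (i : 'I_2) : i = 0 \/ i = 1.
Proof. by case: i => [[|[|]]] // lt2; [left | right]; apply: val_inj. Qed.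

Lemma toXYK (K : comNzRingType) : cancel (@toXY K) (@ofXY K).
Proof.
apply: (@rmorph_mpoly_eq K _ 2 (@ofXY K \o @toXY K) idfun) => [c|i] /=.
  by rewrite toXYC ofXYC ofXC.
by case: (ord2P i) => ->; rewrite toXYX ?ofXYC ?ofXX ?ofXYX.
Qed.

Lemma ofXYK (K : comNzRingType) : cancel (@ofXY K) (@toXY K).
Proof.
have ofXK (c : {poly K}) : toXY (ofX c) = c%:P.
  elim/poly_ind: c => [|c k IHc]; first by rewrite !rmorph0.
  by rewrite !rmorphD !rmorphM /= IHc ofXC ofXX toXYC toXYX.
elim/poly_ind=> [|p c IHp]; first by rewrite !rmorph0.
by rewrite !rmorphD !rmorphM /= IHp ofXYC ofXYX toXYX ofXK.
Qed.

Definition pt2 (K : Type) (p : K * K) : 'I_2 -> K := fun i => if i == 0 then p.1 else p.2.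

Lemma meval_toXY (K : comNzRingType) (p : K * K) (f : {mpoly K[2]}) :
  f.@[pt2 p] = (toXY f).[p.2%:P].[p.1].
Proof.
apply: (@rmorph_mpoly_eq K K 2 (meval (pt2 p))
  (horner_eval p.1 \o horner_eval p.2%:P \o @toXY K)) => [c|i] /=.
  by rewrite mevalC toXYC /horner_eval !hornerC.
by rewrite mevalXU toXYX /pt2 /horner_eval; case: ifP => _; rewrite ?(hornerC, hornerX).
Qed.

Lemma nonconst_msize (K : nzRingType) n (p : {mpoly K[n]}) : nonconst p <-> (1 < msize p)%N.
Proof.
split=> [ncp|sz [c Dc]].
  by rewrite ltnNge; apply/negP=> /msize1_polyC Dp; apply: ncp; eexists; apply: Dp.
by move: sz; rewrite Dc msizeC; case: (c == 0).
Qed.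

Definition irred (K : nzRingType) n (f : {mpoly K[n]}) :=
  nonconst f /\ forall a b, f = a * b -> ~ (nonconst a /\ nonconst b).

Lemma irred_toXY (K : comNzRingType) (f : {mpoly K[2]}) : irred f -> irredXY (toXY f).
Proof.
have scal (a : {poly {poly K}}) : ~ scalarXY a -> nonconst (ofXY a).
  by move=> nsc [c Dc]; apply: nsc; exists c; rewrite -(ofXYK a) Dc toXYC.
move=> [ncf irr]; split=> [[c Dc]|a b Dab].
  by apply: ncf; exists c; apply: (can_inj (@toXYK K)); rewrite Dc toXYC.
have := irr (ofXY a) (ofXY b); rewrite -rmorphM -Dab /= toXYK => /(_ erefl) ncab.
case: (boolp.EM (scalarXY a)) => [|nsa]; [by left | right].
by apply: boolp.contrapT => nsb; apply: ncab; split; apply: scal.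
Qed.

Lemma irred_prime (K : closedFieldType) (f g u v : {mpoly K[2]}) :
  irred f -> f * u = g * v ->
  (exists g', g = f * g') \/ (exists v', v = f * v').
Proof.
move/irred_toXY=> irrf /(congr1 (@toXY K)); rewrite !rmorphM /=.
case/(irredXY_prime irrf) => [[w /(congr1 (@ofXY K))]|[w /(congr1 (@ofXY K))]];
  rewrite rmorphM /= !toXYK => ->; by [left; eexists | right; eexists].
Qed.

(** * Zero sets of nonconstant polynomials are infinite *)

(** A new zero is obtained by giving one coordinate a value not occurring in [s]: the second if [G]
    depends on the first alone, else the first, chosen so that the degree in the second does not
    drop. *)
Lemma nonconst_zero_notin (K : closedFieldType) (G : {mpoly K[2]}) (s : seq (K * K)) :
  nonconst G -> exists2 p, p \notin s & G.@[pt2 p] = 0.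
Proof.
move=> ncG; set g := toXY G.
have fresh (l : {poly K}) (r : seq K) : l != 0 ->
    exists2 a, a \notin r & ~~ root l a.
  move=> l0; have : l * \prod_(b <- r) ('X - b%:P) != 0.
    by rewrite mulf_neq0 // prodf_seq_neq0; apply/allP=> b _ /=; rewrite polyXsubC_eq0.
  case/closed_nonrootP=> a; rewrite rootM negb_or root_prod_XsubC => /andP[la ra].
  by exists a.
have [szg|szg] := leqP (size g) 1.
  have Dg := size1_polyC szg; set c := g`_0 in Dg.
  have : size c != 1.
    apply/negP=> /size_poly1P[k _ Dk]; apply: ncG; exists k.
    by apply: (can_inj (@toXYK K)); rewrite toXYC -Dk.
  case/closed_rootP=> a /rootP ca.
  have [b sb _] := fresh 1 [seq p.2 | p <- s] (oner_neq0 _).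
  exists (a, b); first by apply: contraNN sb => /(map_f snd).
  by rewrite meval_toXY -/g Dg hornerC.
have l0 : lead_coef g != 0 by rewrite lead_coef_eq0 -size_poly_gt0 ltnW.
have [a sa la] := fresh _ [seq p.1 | p <- s] l0.
have szga : size (map_poly (horner_eval a) g) = size g.
  by rewrite size_poly_eq //= -rootE.
have : size (map_poly (horner_eval a) g) != 1 by rewrite szga neq_ltn szg orbT.
case/closed_rootP=> b /rootP gb; exists (a, b).
  by apply: contraNN sa => /(map_f fst).
rewrite meval_toXY -/g /=; have := horner_map (horner_eval a) g b%:P.
by rewrite /= [horner_eval a _%:P]hornerC gb => /esym.
Qed.

Lemma nonconst_card_zeros (K : closedFieldType) (G : {mpoly K[2]}) n :
  nonconst G -> card_gt (fun p => G.@[pt2 p] = 0) n.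
Proof.
move=> ncG; suff [s [us sP szs]] : exists s : seq (K * K),
    [/\ uniq s, forall p, p \in s -> G.@[pt2 p] = 0 & size s = n.+1].
  by exists s; rewrite szs.
elim: n.+1 => [|m [s [us sP szs]]]; first by exists [::].
have [p sp Gp] := nonconst_zero_notin s ncG.
exists (p :: s); split; rewrite /= ?sp ?us ?szs //.
by move=> q; rewrite inE => /predU1P[->|/sP].
Qed.

(** * Coefficient vectors of polynomials of degree less than [k], and their dimension *)

Definition nmon k := #|{: 'X_{1..2 < k}}|.

Definition mon k (i : 'I_(nmon k)) : 'X_{1..2} := enum_val i.

Definition polyv (K : nzRingType) k (v : 'rV[K]_(nmon k)) : {mpoly K[2]} :=
  \sum_i v 0 i *: 'X_[mon i].

(** Terms of degree [k] or more are dropped, hence the size bounds in later lemmas. *)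
Definition vecp (K : nzRingType) k (p : {mpoly K[2]}) : 'rV[K]_(nmon k) :=
  \row_i p@_(mon i).

Lemma mon_inj k : injective (@mon k).
Proof. by move=> i j /val_inj /enum_val_inj. Qed.

Lemma mdeg_mon k (i : 'I_(nmon k)) : (mdeg (mon i) < k)%N.
Proof. exact: bmdeg. Qed.

Lemma monP k (m : 'X_{1..2}) : (mdeg m < k)%N -> exists i : 'I_(nmon k), mon i = m.
Proof.
by move=> lt_mk; exists (enum_rank (BMultinom lt_mk)); rewrite /mon enum_rankK.
Qed.

Lemma card_pair_addn_lt k :
  (#|[set p : 'I_k * 'I_k | p.1 + p.2 < k]| * 2 = k * k.+1)%N.
Proof.
rewrite -sum1dep_card -(pair_big_dep xpredT (fun i j : 'I_k => (i + j < k)%N)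
  (fun _ _ => 1%N)) /=.
transitivity ((\sum_(i < k) (k - i)) * 2)%N.
  congr (_ * 2)%N; apply: eq_bigr => i _.
  rewrite sum1dep_card.
  have le_k : (k - i <= k)%N by rewrite leq_subr.
  have winj : injective (widen_ord le_k) by move=> a b [] /val_inj.
  rewrite -[RHS]card_ord -(card_imset _ winj).
  apply: eq_card => j; rewrite inE; apply/idP/imsetP => [lt_ij|[l _ ->]].
    have lt_j : (j < k - i)%N by lia.
    by exists (Ordinal lt_j) => //; apply: val_inj.
  by rewrite /=; have := ltn_ord l; lia.
elim: k => [|k IHk]; first by rewrite big_ord0.
by rewrite big_ord_recl /= mulnDl IHk; lia.
Qed.

Lemma nmon_mul2 k : (nmon k * 2 = k * k.+1)%N.
Proof.
rewrite -card_pair_addn_lt; congr (_ * 2)%N.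
(* [inord] below needs a nonempty target, so [k = 0] is treated apart. *)
case: k => [|k].
  have n0 : #|[set p : 'I_0 * 'I_0 | (p.1 + p.2 < 0)%N]| = 0%N.
    by apply: eq_card0 => -[[]].
  by rewrite n0; apply: eq_card0 => -[m].
have mdeg2 (m : 'X_{1..2}) : mdeg m = (m 0%R + m 1%R)%N.
  by rewrite mdegE !big_ord_recl big_ord0 addn0; congr (m _ + m _)%N; apply: val_inj.
pose h (m : 'X_{1..2 < k.+1}) : 'I_k.+1 * 'I_k.+1 := (inord (bmnm m 0), inord (bmnm m 1)).
have hE m : (h m).1 = bmnm m 0 :> nat /\ (h m).2 = bmnm m 1 :> nat.
  by have := bmdeg m; rewrite mdeg2 => lt; rewrite !inordK //; lia.
have h_inj : injective h.
  move=> m1 m2 Eh; apply: val_inj; apply/mnmP => i.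
  have [E1 E2] := hE m1; have [E3 E4] := hE m2; rewrite Eh in E1 E2.
  by case: (ord2P i) => ->; rewrite -?E1 -?E2.
rewrite /nmon -(card_imset _ h_inj); apply: eq_card => -[i j].
rewrite inE; apply/imsetP/idP => [[m _ Em]|lt_ij].
  by have := hE m; rewrite -Em => -[/= -> ->]; rewrite -mdeg2 bmdeg.
pose m : 'X_{1..2} := [multinom (if l == 0%R then i : nat else j) | l < 2].
have lt_m : (mdeg m < k.+1)%N by rewrite mdeg2 !mnmE.
exists (BMultinom lt_m) => //.
have [E1 E2] := hE (BMultinom lt_m).
rewrite [h _]surjective_pairing; congr pair; apply: ord_inj.
  by rewrite E1 mnmE.
by rewrite E2 mnmE.
Qed.

(** The mixed second difference of k(k+1)/2 is the source of the product of degrees in Bezout's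
    inequality. *)
Lemma nmon_second_diff m n r :
  (nmon (m + n + r) + nmon r = nmon (n + r) + nmon (m + r) + m * n)%N.
Proof.
have := nmon_mul2 (m + n + r); have := nmon_mul2 (n + r).
have := nmon_mul2 (m + r); have := nmon_mul2 r.
move: (nmon _) (nmon _) (nmon _) (nmon _) => a b c e; lia.
Qed.

Lemma polyvK (K : nzRingType) k : cancel (@polyv K k) (@vecp K k).
Proof.
move=> v; apply/rowP=> j; rewrite mxE raddf_sum (bigD1 j) //= mcoeffZ mcoeffX eqxx mulr1.
rewrite big1 ?addr0 // => i ne_ij; rewrite mcoeffZ mcoeffX.
by rewrite (inj_eq (@mon_inj k)) (negPf ne_ij) mulr0.
Qed.

Lemma vecpK (K : nzRingType) k (p : {mpoly K[2]}) : (msize p <= k)%N -> polyv (vecp k p) = p.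
Proof.
move=> szp; rewrite [RHS](mpolywE szp).
rewrite (reindex (fun i : 'I_(nmon k) => enum_val i)) /=; last first.
  by apply: onW_bij; apply: enum_val_bij.
by apply: eq_bigr => i _; rewrite mxE.
Qed.

Lemma msize_polyv (K : nzRingType) k (v : 'rV[K]_(nmon k)) : (msize (polyv v) <= k)%N.
Proof.
apply: leq_trans (msize_sum _ _ _) _; apply/bigmax_leqP => i _.
by apply: leq_trans (msizeZ_le _ _) _; rewrite msizeX mdeg_mon.
Qed.

Lemma polyv0 (K : nzRingType) k : polyv (0 : 'rV[K]_(nmon k)) = 0.
Proof. by rewrite /polyv big1 // => i _; rewrite mxE scale0r. Qed.

Lemma polyv_mulmx (K : nzRingType) n k (v : 'rV[K]_n) (A : 'M_(n, nmon k)) :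
  polyv (v *m A) = \sum_i v 0 i *: polyv (row i A).
Proof.
under eq_bigr do rewrite scaler_sumr.
rewrite exchange_big; apply: eq_bigr => j _.
rewrite mxE scaler_suml; apply: eq_bigr => i _.
by rewrite mxE scalerA.
Qed.

(** * Ranks of multiplication and evaluation maps *)

Definition mulM (K : nzRingType) k k' (f : {mpoly K[2]}) : 'M[K]_(nmon k, nmon k') :=
  \matrix_i vecp k' (f * 'X_[mon i]).

Lemma msizeM_leq (K : idomainType) n (p q : {mpoly K[n]}) :
  (msize (p * q) <= (msize p + msize q).-1)%N.
Proof.
have [->|p0] := eqVneq p 0; first by rewrite mul0r msize0.
have [->|q0] := eqVneq q 0; first by rewrite mulr0 msize0.
by rewrite msizeM.
Qed.

Lemma polyv_mulM (K : idomainType) k k' (f : {mpoly K[2]}) (v : 'rV_(nmon k)) :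
  (msize f + k <= k'.+1)%N -> polyv (v *m mulM k k' f) = f * polyv v.
Proof.
move=> le_k; rewrite polyv_mulmx mulr_sumr; apply: eq_bigr => i _.
rewrite rowK vecpK ?scalerAr //.
apply: leq_trans (msizeM_leq _ _) _; rewrite msizeX.
by have := mdeg_mon i; lia.
Qed.

(** Multiplication by [f] is injective, and the size bound rules out truncation. *)
Lemma mxrank_mulM (K : fieldType) k k' (f : {mpoly K[2]}) :
  f != 0 -> (msize f + k <= k'.+1)%N -> \rank (mulM k k' f) = nmon k.
Proof.
move=> f0 le_k; apply/eqP/inj_row_free => v v0.
apply: (can_inj (@polyvK K k)); apply/eqP; rewrite polyv0.
have := polyv_mulM v le_k; rewrite v0 polyv0 => /esym/eqP.
by rewrite mulf_eq0 (negPf f0).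
Qed.

Definition evM (K : nzRingType) k (s : seq (K * K)) : 'M[K]_(nmon k, size s) :=
  \matrix_(i, j) ('X_[mon i]).@[pt2 (nth 0 s j)].

Lemma mulmx_evM (K : comNzRingType) k (s : seq (K * K)) (v : 'rV_(nmon k)) j :
  (v *m evM k s) 0 j = (polyv v).@[pt2 (nth 0 s j)].
Proof.
by rewrite mxE raddf_sum; apply: eq_bigr => i _; rewrite mxE /= mevalZ.
Qed.

(* A line through [q] that misses [p], when [p != q]. *)
Definition sep_line (K : nzRingType) (p q : K * K) : {mpoly K[2]} :=
  if p.1 == q.1 then 'X_1 - q.2%:MP else 'X_0 - q.1%:MP.

Lemma msize_prod_sep_line (K : idomainType) (p : K * K) s :
  (msize (\prod_(q <- s) sep_line p q) <= (size s).+1)%N.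
Proof.
elim: s => [|q s IHs]; first by rewrite big_nil msize1.
have sz2 : (msize (sep_line p q) <= 2)%N.
  rewrite /sep_line; case: ifP => _; apply: leq_trans (msizeD_le _ _) _;
  by rewrite msizeN msizeX mdeg1 geq_max /= msizeC; case: (_ != 0).
rewrite big_cons; apply: leq_trans (msizeM_leq _ _) _.
by have := leq_add sz2 IHs; case: (_ + _)%N.
Qed.

Lemma meval_sep_line (K : comNzRingType) (p q : K * K) :
  ((sep_line p q).@[pt2 q] = 0) * (p != q -> (sep_line p q).@[pt2 p] != 0).
Proof.
rewrite /sep_line; split.
  by case: ifP => _; rewrite mevalB mevalXU mevalC /pt2 /= subrr.
move=> ne_pq; case: ifP => [/eqP E1|/negbT ne1];
  rewrite mevalB mevalXU mevalC /pt2 /= subr_eq0 //.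
by apply: contraNneq ne_pq => E2; rewrite [p]surjective_pairing E1 E2 -surjective_pairing.
Qed.

(** Lagrange interpolation: for each point, a product of lines through the other points, normalised,
    has degree less than [k]; these polynomials are the rows of a left inverse. *)
Lemma mxrank_evM (K : fieldType) k (s : seq (K * K)) :
  uniq s -> (size s <= k)%N -> \rank (evM k s) = size s.
Proof.
move=> us le_sk; apply/eqP.
pose P (j : 'I_(size s)) := \prod_(q <- rem (nth 0 s j) s) sep_line (nth 0 s j) q.
pose L (j : 'I_(size s)) := (P j).@[pt2 (nth 0 s j)]^-1 *: P j.
apply/row_fullP; exists (\matrix_j vecp k (L j)).
apply/row_matrixP => i; rewrite row_mul rowK; apply/rowP => j.
have szP : (msize (P i) <= k)%N.
  apply: leq_trans (msize_prod_sep_line _ _) _; rewrite size_rem ?mem_nth //.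
  by rewrite prednK // (leq_ltn_trans _ (ltn_ord i)).
rewrite mulmx_evM vecpK; last by apply: leq_trans (msizeZ_le _ _) _.
rewrite mevalZ !mxE; have [<-|ne_ij] := eqVneq i j.
  rewrite mulVf // rmorph_prod prodf_seq_neq0; apply/allP => q /=.
  by rewrite mem_rem_uniq // inE eq_sym => /andP[ne_q _]; apply: (meval_sep_line _ _).2.
rewrite (_ : (P i).@[pt2 (nth 0 s j)] = 0) ?mulr0 //; apply/eqP.
rewrite rmorph_prod prodf_seq_eq0; apply/hasP; exists (nth 0 s j) => /=.
  by rewrite mem_rem_uniq // inE nth_uniq // mem_nth // andbT eq_sym.
by rewrite meval_sep_line.
Qed.

(* The polynomials of degree [< k] vanishing on [s] form a space of codimension
   [size s] for large [k]; it contains [f V + g V], whose dimension is known since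
   [f V] and [g V] meet in [f g V]. *)
Lemma bezout_irred (K : closedFieldType) (f g : {mpoly K[2]}) (s : seq (K * K)) :
  irred f -> ~ (exists w, g = f * w) -> uniq s ->
  (forall p, p \in s -> f.@[pt2 p] = 0 /\ g.@[pt2 p] = 0) ->
  (size s <= (msize f).-1 * (msize g).-1)%N.
Proof.
move=> irrf ndvd us sP.
have szf : (1 < msize f)%N by apply/nonconst_msize; case: irrf.
have f0 : f != 0 by rewrite -msize_poly_eq0 -lt0n ltnW.
have g0 : g != 0 by apply/eqP => g0; apply: ndvd; exists 0; rewrite mulr0.
have szg : (0 < msize g)%N by rewrite lt0n msize_poly_eq0.
set m := (msize f).-1; set n := (msize g).-1; set r := size s.
have Df : msize f = m.+1 by rewrite /m; lia.
have Dg : msize g = n.+1 by rewrite /n; lia.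
pose k := (m + n + r)%N.
pose A := mulM (n + r) k f; pose B := mulM (m + r) k g.
pose C := mulM r k (f * g); pose E := evM k s.
have leA : (msize f + (n + r) <= k.+1)%N by rewrite Df /k; lia.
have leB : (msize g + (m + r) <= k.+1)%N by rewrite Dg /k; lia.
have fg0 : f * g != 0 by rewrite mulf_neq0.
have leC : (msize (f * g) + r <= k.+1)%N by rewrite msizeM // Df Dg /k; lia.
have rA : \rank A = nmon (n + r) by apply: mxrank_mulM.
have rB : \rank B = nmon (m + r) by apply: mxrank_mulM.
have rE : \rank E = r by apply: mxrank_evM; rewrite // /k leq_addl.
have rC : (\rank C <= nmon r)%N by apply: rank_leq_row.
have mulE0 h l : (msize h + l <= k.+1)%N ->
    (forall p, p \in s -> h.@[pt2 p] = 0) -> mulM l k h *m E = 0.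
  move=> le_h hP; apply/row_matrixP => i; apply/rowP => j.
  rewrite row_mul rowE mulmx_evM polyv_mulM // mevalM.
  by rewrite hP ?mem_nth // mul0r !mxE.
have rAB : (\rank (A + B)%MS <= nmon k - r)%N.
  have <- : \rank (kermx E) = (nmon k - r)%N by rewrite mxrank_ker rE.
  rewrite mxrankS // addsmx_sub !sub_kermx.
  by rewrite !mulE0 ?eqxx // => p /sP[].
(* If [f a = g b], the prime [f] does not divide [g], so [b = f w] and the common value is
   [f g w]. *)
have capAB : (A :&: B <= C)%MS.
  apply/rV_subP => u; rewrite sub_capmx => /andP[/submxP[a Da] /submxP[b Db]].
  have Efg : f * polyv a = g * polyv b.
    by rewrite -(polyv_mulM _ leA) -(polyv_mulM _ leB) -Da -Db.
  case: (irred_prime irrf Efg) => // -[w Dw].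
  have szw : (msize w <= r)%N.
    have [->|w0] := eqVneq w 0; first by rewrite msize0.
    by have := msize_polyv b; rewrite Dw msizeM // Df addSn leq_add2l.
  apply/submxP; exists (vecp r w); apply: (can_inj (@polyvK K k)).
  by rewrite polyv_mulM // vecpK // Db polyv_mulM // Dw mulrCA mulrA.
have rcap := leq_trans (mxrankS capAB) rC.
have sumAB := mxrank_sum_cap A B; rewrite rA rB in sumAB.
(* Keeps the truncated subtraction [nmon k - r] exact. The rank formula for [A + B] then bounds [r]
   by the second difference [m * n]. *)
have le_rk : (r <= nmon k)%N by rewrite -rE rank_leq_row.
have := nmon_second_diff m n r; rewrite -/k => diff.
rewrite -(leq_add2l (nmon k - r + nmon r)) addnAC subnK // diff -sumAB.
by rewrite leq_add2r leq_add.
Qed.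

(** Induction on the degree of [f]: an irreducible [f] fails to divide some member of [U], to which
    [bezout_irred] applies; for a product, the points are shared out between the factors, whose
    degrees add up. *)
Lemma bezout_family (K : closedFieldType) d (U : {mpoly K[2]} -> Prop)
    (f : {mpoly K[2]}) (s : seq (K * K)) :
  f != 0 -> (forall g, U g -> (msize g <= d.+1)%N) ->
  (forall G, nonconst G -> (exists w, f = G * w) ->
     ~ forall g, U g -> exists w, g = G * w) ->
  uniq s -> (forall p, p \in s -> f.@[pt2 p] = 0 /\ forall g, U g -> g.@[pt2 p] = 0) ->
  (size s <= (msize f).-1 * d)%N.
Proof.
move=> f0 szU; have [n] := ubnP (msize f).
elim: n f s f0 => // n IHn f s f0 lt_fn nodvd us sP.
have [szf|szf] := leqP (msize f) 1.
  (* A nonzero constant has no zeros, so [s] is empty. *)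
  case: s us sP => // p s _ /(_ p (mem_head _ _))[fp _].
  move: f0 fp; rewrite (msize1_polyC szf) mevalC mpolyC_eq0.
  by move=> /eqP c0 c_eq0.
have ncf : nonconst f by apply/nonconst_msize.
case: (boolp.EM (irred f)) => [irrf|].
  case: (boolp.EM (exists2 g, U g & ~ exists w, g = f * w)) => [[g Ug ndvd]|dvdU].
    apply: leq_trans (bezout_irred irrf ndvd us _) _ => [p /sP[fp /(_ _ Ug)]|] //.
    by rewrite leq_mul2l -[(msize g).-1]subn1 leq_subLR szU ?orbT.
  case: (nodvd f) => //; first by exists 1; rewrite mulr1.
  by move=> g Ug; apply: boolp.contrapT => ndvd; apply: dvdU; exists g.
move=> nirr; have [a [b [Dab nca ncb]]] : exists a b, [/\ f = a * b, nonconst a & nonconst b].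
  apply: boolp.contrapT => nab; apply: nirr; split=> // a b Dab [nca ncb].
  by apply: nab; exists a, b.
have /nonconst_msize sza := nca; have /nonconst_msize szb := ncb.
have a0 : a != 0 by apply: contraNneq f0 => a0; rewrite Dab a0 mul0r.
have b0 : b != 0 by apply: contraNneq f0 => b0; rewrite Dab b0 mulr0.
have szab : msize f = (msize a + msize b).-1 by rewrite Dab msizeM.
have [lt_an lt_bn] : (msize a < n)%N /\ (msize b < n)%N.
  by move: sza szb szab lt_fn; move: (msize a) (msize b) (msize f) => x y z; lia.
(* Each point goes to [a] if it is a zero of [a], and otherwise to [b], so none is counted twice. *)
pose za := [pred p | a.@[pt2 p] == 0].
have le_a : (size (filter za s) <= (msize a).-1 * d)%N.
  apply: IHn; rewrite ?filter_uniq //.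
    move=> G ncG [w Dw]; apply: nodvd => //; exists (w * b).
    by rewrite Dab Dw mulrA.
  move=> p; rewrite mem_filter => /andP[/eqP ap /sP[_ Up]].
  by split.
have le_b : (size (filter (predC za) s) <= (msize b).-1 * d)%N.
  apply: IHn; rewrite ?filter_uniq //.
    move=> G ncG [w Dw]; apply: nodvd => //; exists (a * w).
    by rewrite Dab Dw mulrCA.
  move=> p; rewrite mem_filter => /andP[/= ap /sP[fp Up]].
  by split=> //; move/eqP: fp; rewrite Dab mevalM mulf_eq0 (negPf ap) => /eqP.
rewrite -(count_predC za) -!size_filter; apply: leq_trans (leq_add le_a le_b) _.
rewrite -mulnDl leq_mul2r orbC szab.
by move: sza szb; move: (msize a) (msize b) => x y; lia.
Qed.

Lemma common_factor (K : closedFieldType) d (U : {mpoly K[2]} -> Prop) (s : seq (K * K)) :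
  (forall g, U g -> (msize g <= d.+1)%N) -> uniq s -> (d ^ 2 < size s)%N ->
  (forall p g, p \in s -> U g -> g.@[pt2 p] = 0) ->
  exists2 G, nonconst G & forall g, U g -> exists w, g = G * w.
Proof.
move=> szU us lt_ds sP.
case: (boolp.EM (exists2 f, U f & f != 0)) => [[f Uf f0]|U0].
  apply: boolp.contrapT => noG; move: lt_ds; rewrite ltnNge => /negP[].
  apply: leq_trans (bezout_family f0 szU _ us _) _.
  - by move=> G ncG _ dvdG; apply: noG; exists G.
  - by move=> p ps; split=> [|g]; apply: sP.
  by rewrite -mulnn leq_mul2r -subn1 leq_subLR szU ?orbT.
(* Here [U] contains at most the zero polynomial, so any nonconstant polynomial would serve. *)
exists 'X_0; first by apply/nonconst_msize; rewrite msizeX mdeg1.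
move=> g Ug; exists 0; rewrite mulr0.
by apply/eqP; apply: contra_notT U0 => g0; exists g.
Qed.

(** * Polynomials in four variables as coefficient matrices *)

(** Realises the tensor product of K[x,y] and K[s,t]: multiplying [C] on the left acts on the
    [x,y]-side, on the right on the [s,t]-side. *)
Definition bil (K : comNzRingType) k (C : 'M[K]_(nmon k)) : {mpoly K[4]} :=
  \sum_i \sum_j C i j *: (in_xy 'X_[mon i] * in_st 'X_[mon j]).

Lemma in_xy_polyv (K : comNzRingType) k (v : 'rV[K]_(nmon k)) :
  in_xy (polyv v) = \sum_i v 0 i *: in_xy 'X_[mon i].
Proof.
by rewrite /in_xy raddf_sum; apply: eq_bigr => i _; rewrite /= comp_mpolyZ.
Qed.

Lemma in_st_polyv (K : comNzRingType) k (v : 'rV[K]_(nmon k)) :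
  in_st (polyv v) = \sum_i v 0 i *: in_st 'X_[mon i].
Proof.
by rewrite /in_st raddf_sum; apply: eq_bigr => i _; rewrite /= comp_mpolyZ.
Qed.

Lemma bil_rows (K : comNzRingType) k (C : 'M[K]_(nmon k)) :
  bil C = \sum_i in_xy 'X_[mon i] * in_st (polyv (row i C)).
Proof.
apply: eq_bigr => i _; rewrite in_st_polyv mulr_sumr; apply: eq_bigr => j _.
by rewrite mxE scalerAr.
Qed.

Lemma bil_cols (K : comNzRingType) k (C : 'M[K]_(nmon k)) :
  bil C = \sum_j in_xy (polyv (row j C^T)) * in_st 'X_[mon j].
Proof.
rewrite /bil exchange_big; apply: eq_bigr => j _.
rewrite in_xy_polyv mulr_suml; apply: eq_bigr => i _.
by rewrite !mxE scalerAl.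
Qed.

Lemma bilD (K : comNzRingType) k (C D : 'M[K]_(nmon k)) : bil (C + D) = bil C + bil D.
Proof.
rewrite /bil -big_split; apply: eq_bigr => i _; rewrite -big_split /=.
by apply: eq_bigr => j _; rewrite mxE scalerDl.
Qed.

Lemma meval_in_xy (K : comNzRingType) (p q : K * K) (G : {mpoly K[2]}) :
  (in_xy G).@[pt4 p q] = G.@[pt2 p].
Proof.
rewrite /in_xy comp_mpoly_meval; apply: meval_eq => i.
by case: (ord2P i) => ->; rewrite (tnth_nth 0) /= mevalXU /pt4 /pt2 /= inordK.
Qed.

Lemma meval_in_st (K : comNzRingType) (p q : K * K) (G : {mpoly K[2]}) :
  (in_st G).@[pt4 p q] = G.@[pt2 q].
Proof.
rewrite /in_st comp_mpoly_meval; apply: meval_eq => i.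
by case: (ord2P i) => ->; rewrite (tnth_nth 0) /= mevalXU /pt4 /pt2 /= inordK.
Qed.

Lemma mpolyX4 (K : comNzRingType) (m : 'X_{1..4}) :
  'X_[m] = in_xy 'X_[[multinom m (if i == 0%R then vx else vy) | i < 2]]
         * in_st 'X_[[multinom m (if i == 0%R then vs else vt) | i < 2]] :> {mpoly K[4]}.
Proof.
rewrite /in_xy /in_st !comp_mpolyX mpolyXE_id !big_ord_recl !big_ord0 !mulr1.
rewrite !(tnth_nth 0) /= !mnmE /= mulrA.
have -> : vx = ord0 by apply: val_inj; rewrite /= inordK.
have -> : vy = lift ord0 ord0 by apply: val_inj; rewrite /= inordK.
have -> : vs = lift ord0 (lift ord0 ord0) by apply: val_inj; rewrite /= inordK.
have -> : vt = lift ord0 (lift ord0 (lift ord0 ord0)) by apply: val_inj; rewrite /= inordK.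
by rewrite !mulrA.
Qed.

(** The [x,y]-part and the [s,t]-part of a monomial each have degree at most its total degree. *)
Lemma bil_surj (K : comNzRingType) k (F : {mpoly K[4]}) :
  (msize F <= k)%N -> exists C : 'M[K]_(nmon k), F = bil C.
Proof.
move=> szF; rewrite [F]mpolyE big_seq.
apply: (big_ind (fun F => exists C : 'M[K]_(nmon k), F = bil C)).
- by exists 0; rewrite /bil big1 // => i _; rewrite big1 // => j _; rewrite mxE scale0r.
- by move=> _ _ [C1 ->] [C2 ->]; exists (C1 + C2); rewrite bilD.
move=> m /msize_mdeg_lt /leq_trans/(_ szF) lt_mk.
have mdeg4 : mdeg m = (m vx + m vy + (m vs + m vt))%N.
  rewrite mdegE !big_ord_recl big_ord0 addn0 -!addnA.
  by do ![congr (_ + _)%N]; congr (m _); apply: val_inj; rewrite /= inordK.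
have mdeg2 a b : mdeg [multinom m (if i == 0%R then a else b) | i < 2] = (m a + m b)%N.
  by rewrite mdegE !big_ord_recl big_ord0 addn0 !mnmE.
rewrite mpolyX4.
have [|i Di] := @monP k [multinom m (if i == 0%R then vx else vy) | i < 2].
  by rewrite mdeg2; apply: leq_ltn_trans lt_mk; rewrite mdeg4 leq_addr.
have [|j Dj] := @monP k [multinom m (if i == 0%R then vs else vt) | i < 2].
  by rewrite mdeg2; apply: leq_ltn_trans lt_mk; rewrite mdeg4 leq_addl.
exists (F@_m *: delta_mx i j); rewrite -Di -Dj /bil (bigD1 i) //=.
rewrite [X in _ + X]big1 => [|l /negPf ne]; last first.
  by rewrite big1 // => l' _; rewrite !mxE ne mulr0 scale0r.
rewrite addr0 (bigD1 j) //= big1 ?addr0 => [|l /negPf ne].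
  by rewrite !mxE !eqxx mulr1.
by rewrite !mxE ne andbF mulr0 scale0r.
Qed.

(** Identifies the columns of [C *m evM k t] as coefficient vectors of the slices at the points of
    [t]. *)
Lemma meval_bil (K : comNzRingType) k (C : 'M[K]_(nmon k)) (p : K * K) t (j : 'I_(size t)) :
  (bil C).@[pt4 p (nth 0 t j)] = (polyv (row j (C *m evM k t)^T)).@[pt2 p].
Proof.
rewrite bil_rows !raddf_sum; apply: eq_bigr => i _ /=.
rewrite mevalM meval_in_xy meval_in_st -mulmx_evM mevalZ mulrC; congr (_ * _).
by rewrite -row_mul !mxE.
Qed.

(** * Splitting [F] by a projection, and the equivalence *)

Lemma cartesian_of_zeros (K : closedFieldType) (F : {mpoly K[4]}) (s t : seq (K * K)) :
  uniq s -> uniq t -> (mtdeg F ^ 2 < size s)%N -> (mtdeg F ^ 2 < size t)%N ->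
  (forall p q, p \in s -> q \in t -> F.@[pt4 p q] = 0) -> cartesian F.
Proof.
move=> us ut lt_s lt_t F0; set d := mtdeg F in lt_s lt_t; pose k := d.+1.
have [C DF] : exists C : 'M[K]_(nmon k), F = bil C by apply: bil_surj; apply: leqSpred.
pose A := (C *m evM k t)^T.
have [g [j ->]|||p g ps [j ->]|G ncG dvdG] :=
  @common_factor K d (fun g => exists j, g = polyv (row j A)) s.
- exact: msize_polyv.
- by [].
- by [].
- by rewrite -meval_bil -DF F0 // mem_nth.
(* Acting on row vectors from the right, [P] is a projection onto the row space of [A], the span of
   the slices. *)
pose P := pinvmx A *m A.
have AP : A *m P = A by rewrite mulmxA mulmxKpV.
pose D := C - P^T *m C.
(* Since [C *m evM k t] is the transpose of [A], this is the transpose of [A - A *m P = 0]: the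
   [s,t]-coefficients of the remainder vanish on [t]. *)
have DE : D *m evM k t = 0.
  rewrite mulmxBl -mulmxA -[C *m _]trmxK -/A -trmx_mul.
  by rewrite AP subrr.
have [g [i ->]|||q g qt [i ->]|Kp ncK dvdK] :=
  @common_factor K d (fun g => exists i, g = polyv (row i D)) t.
- exact: msize_polyv.
- by [].
- by [].
- have lt_q : (index q t < size t)%N by rewrite index_mem.
  rewrite -(nth_index 0 qt) -(mulmx_evM _ (Ordinal lt_q)).
  by rewrite -row_mul DE !mxE.
have [w Dw] : exists w : 'I_(size t) -> {mpoly K[2]}, forall j, polyv (row j A) = G * w j.
  apply: (@fin_all_exists _ (fun=> {mpoly K[2]}) (fun j w => polyv (row j A) = G * w)).
  by move=> j; apply: dvdG; exists j.
have [l Dl] : exists l : 'I_(nmon k) -> {mpoly K[2]}, forall i, polyv (row i D) = Kp * l i.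
  apply: (@fin_all_exists _ (fun=> {mpoly K[2]}) (fun i l => polyv (row i D) = Kp * l)).
  by move=> i; apply: dvdK; exists i.
(* The transpose of [P^T *m C] is [B *m A], so [B] expresses the [x,y]-coefficients of the projected
   part through slices, each divisible by [G]. *)
pose B := C^T *m pinvmx A.
exists G, Kp, (\sum_j in_xy (\sum_i B j i *: w i) * in_st 'X_[mon j]),
  (\sum_i in_xy 'X_[mon i] * in_st (l i)).
split=> //; split=> //.
rewrite DF (_ : C = P^T *m C + D); last by rewrite addrC subrK.
rewrite bilD; congr (_ + _).
  rewrite bil_cols mulr_sumr; apply: eq_bigr => j _.
  rewrite mulrA; congr (_ * _).
  have -> : row j (P^T *m C)^T = row j B *m A.
    by rewrite trmx_mul trmxK mulmxA -row_mul.
  rewrite -[in RHS]rmorphM /=; congr in_xy; rewrite polyv_mulmx mulr_sumr.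
  by apply: eq_bigr => i _; rewrite mxE Dw scalerAr.
rewrite bil_rows mulr_sumr; apply: eq_bigr => i _.
by rewrite mulrCA -[in RHS]rmorphM /= Dl.
Qed.

Theorem cartesian_iff (K : closedFieldType) (F : {mpoly K[4]}) :
  cartesian F <->
  exists I J : (K * K) -> Prop,
    card_gt I ((mtdeg F) ^ 2)%N /\ card_gt J ((mtdeg F) ^ 2)%N /\
    (forall p q, I p -> J q -> F.@[pt4 p q] = 0).
Proof.
split=> [[G [Kp [H [L [ncG [ncK ->]]]]]]|[I [J [[s [us [sI lt_s]]] [[t [ut [tJ lt_t]]] F0]]]]].
  exists (fun p => G.@[pt2 p] = 0), (fun q => Kp.@[pt2 q] = 0).
  split; first exact: nonconst_card_zeros.
  split; first exact: nonconst_card_zeros.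
  move=> p q Gp Kq.
  by rewrite mevalD !mevalM meval_in_xy meval_in_st Gp Kq !mul0r addr0.
by apply: (cartesian_of_zeros us ut lt_s lt_t) => p q /sI Ip /tJ Jq; apply: F0.
Qed.

Theorem theorem2p5 (R : realType) (F : {mpoly (CC R)[4]}) :
  cartesian F <->
  exists (I J : (CC R * CC R) -> Prop),
    card_gt I ((mtdeg F) ^ 2)%N /\ card_gt J ((mtdeg F) ^ 2)%N /\
    (forall p q, I p -> J q -> F.@[pt4 p q] = 0).
Proof.
exact: (@cartesian_iff (complex R)).
Qed.
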